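(* The set $\Gamma_{E(3;3;1,1,1)}\subset\mathbb C^7$ is polynomially convex.
   Context: A compact set $K\subset\mathbb C^n$ is polynomially convex if for every $a\in\mathbb C^n\setminus K$ there is a polynomial $f$ on $\mathbb C^n$ with $|f|\le1$ on $K$ and $|f(a)|>1$. For a linear subspace $E$ of $\mathcal M_{n\times n}(\mathbb C)$, $\mu_E(A)=1/\inf\{\|X\|: X\in E,\ \det(I-AX)=0\}$, with $\mu_E(A)=0$ if $I-AX$ is nonsingular for all $X\in E$ (operator norm). $E(3;3;1,1,1)$ is the space of $3\times 3$ diagonal matrices, and $\Gamma_{E(3;3;1,1,1)}=\{\pi(A): A\in\mathcal M_{3\times3}(\mathbb C),\ \mu_{E(3;3;1,1,1)}(A)\le1\}$ where $$\pi(A)=\big(a_{11},\ a_{22},\ a_{11}a_{22}-a_{12}a_{21},\ a_{33},\ a_{11}a_{33}-a_{13}a_{31},\ a_{22}a_{33}-a_{23}a_{32},\ \det A\big).$$ *)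

(* Defs.v *)
From HB Require Import structures.
From mathcomp Require Import all_boot all_order all_algebra.
From mathcomp Require Import complex.
From mathcomp Require Import all_classical all_reals all_analysis.
(* mpoly is not imported because its notations clash with those of
   mathcomp-analysis. *)
From mathcomp Require mpoly.

Set Implicit Arguments.
Unset Strict Implicit.
Unset Printing Implicit Defensive.

Import Order.TTheory GRing.Theory Num.Theory.
Import numFieldNormedType.Exports.

Local Open Scope classical_set_scope.
Local Open Scope ring_scope.

(* Naming R[i] as a numClosedFieldType gives it, and the row vectors over it,
   the topology that mathcomp-analysis attaches to any numeric closed field,
   i.e. the one of the modulus. *)
Definition C (R : realType) : numClosedFieldType := R[i].

(* In mathcomp the modulus `|z| is again an element of C R; cmod z is the same
   number seen in R. *)
Definition cmod (R : realType) (z : C R) : R := complex.Re `|z|.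

Definition vnorm2 (R : realType) (n : nat) (v : 'cV[C R]_n) : R :=
  Num.sqrt (\sum_(i < n) cmod (v i 0) ^+ 2).

Definition opnorm (R : realType) (n : nat) (X : 'M[C R]_n) : R :=
  sup [set vnorm2 (X *m v) | v in [set v : 'cV[C R]_n | vnorm2 v <= 1]].

Definition polynomially_convex (R : realType) (n : nat) (K : set 'rV[C R]_n) :=
  compact K /\
  forall a : 'rV[C R]_n, ~ K a ->
    exists f : mpoly.mpoly n (C R),
      (forall x, K x -> `|mpoly.meval (fun i => x 0 i) f| <= 1) /\
      1 < `|mpoly.meval (fun i => a 0 i) f|.

(* The infimum is never 0 in the second case, since det (I - AX) = 0 forces
   1 <= ||A|| ||X||; the inverse is therefore a genuine one. *)
Definition mu (R : realType) (n : nat) (E : {pred 'M[C R]_n})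
    (A : 'M[C R]_n) : R :=
  let S := [set X : 'M[C R]_n | X \in E /\ \det (1%:M - A *m X) = 0] in
  if `[< S = set0 >] then 0 else (inf [set opnorm X | X in S])^-1.

(* E(3;3;1,1,1) *)
Definition E3 (R : realType) : {pred 'M[C R]_3} := [pred X | is_diag_mx X].
Arguments E3 R : clear implicits.

Lemma E3_submod_closed (R : realType) : submod_closed (E3 R).
Proof.
split=> [|c X Y /is_diag_mxP X_diag /is_diag_mxP Y_diag]; apply/is_diag_mxP.
  by move=> i j _; rewrite mxE.
by move=> i j ne_ij; rewrite !mxE X_diag // Y_diag // mulr0 addr0.
Qed.

(* Indices start at 0: the entry a_11 is A 0 0, and the coordinates of C^7 are
   numbered from 0 to 6. *)
Definition pi3 (R : realType) (A : 'M[C R]_3) : 'rV[C R]_7 :=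
  \row_(k < 7) [:: A 0 0;
                   A 1 1;
                   A 0 0 * A 1 1 - A 0 1 * A 1 0;
                   A 2 2;
                   A 0 0 * A 2 2 - A 0 2 * A 2 0;
                   A 1 1 * A 2 2 - A 1 2 * A 2 1;
                   \det A]`_k.

Definition Gamma3 (R : realType) : set 'rV[C R]_7 :=
  [set pi3 A | A in [set A : 'M[C R]_3 | mu (E3 R) A <= 1]].
Arguments Gamma3 R : clear implicits.

(* Main.v *)
(* For x = pi(A) and X = diag(z), det(I - A X) is a polynomial det_pol x z, and
   since pi is onto C^7, Gamma is the set of x such that det_pol x has no zero in
   the open unit polydisc.  Fix z with |z_i| <= r and write
     det_pol x (t z) = 1 - e1 t + e2 t^2 - e3 t^3 = prod_i (1 - l_i t).
   If x is in Gamma then |l_i| <= r, so the complete homogeneous symmetric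
   polynomials h_k of l_1, l_2, l_3, which are polynomials in x, satisfy
   |h_k| <= (k + 1)^2 r^k.  Conversely, if det_pol x z = 0 with r < 1, these
   bounds cannot hold for all k: the power series sum_k h_k t^k of
   1 / det_pol x (t z) would converge beyond the zero t = 1 of det_pol x (t z).
   Hence Gamma is cut out by the inequalities |h_k| <= (k + 1)^2 r^k, which makes
   it closed and separates it from every outside point by a polynomial.  It is
   bounded since each coordinate is some e_j at a z with entries 0 and 1. *)
Require Import Defs.
From mathcomp Require Import all_boot all_order all_algebra.
From mathcomp Require Import all_reals.
From mathcomp Require Import complex.
From mathcomp Require Import all_classical all_analysis.
From mathcomp Require Import ring lra zify.
From mathcomp Require mpoly.
Import (canonicals) mpoly.

Set Implicit Arguments.
Unset Strict Implicit.
Unset Printing Implicit Defensive.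

Import Order.TTheory GRing.Theory Num.Theory.
Import numFieldNormedType.Exports.

Local Open Scope classical_set_scope.
Local Open Scope ring_scope.

(** * Complete homogeneous symmetric polynomials of three roots *)

(* The triple (h_k, h_(k-1), h_(k-2)), where h_k is the coefficient of t^k in
   1 / (1 - e1 t + e2 t^2 - e3 t^3) and h_(-1) = h_(-2) = 0. *)
Fixpoint hcomp (S : pzRingType) (e1 e2 e3 : S) (k : nat) : S * S * S :=
  if k is k'.+1 then
    let: (a, b, c) := hcomp e1 e2 e3 k' in (e1 * a - e2 * b + e3 * c, a, b)
  else (1, 0, 0).

Definition hsym (S : pzRingType) (e1 e2 e3 : S) (k : nat) : S :=
  (hcomp e1 e2 e3 k).1.1.

Lemma hsymSSS (S : pzRingType) (e1 e2 e3 : S) k :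
  hsym e1 e2 e3 k.+3 =
  e1 * hsym e1 e2 e3 k.+2 - e2 * hsym e1 e2 e3 k.+1 + e3 * hsym e1 e2 e3 k.
Proof. by rewrite /hsym /=; case: (hcomp _ _ _ k) => [[a b] c]. Qed.

Lemma hsym0 (S : pzRingType) (e1 e2 e3 : S) : hsym e1 e2 e3 0 = 1.
Proof. by []. Qed.

Lemma hsym1 (S : pzRingType) (e1 e2 e3 : S) : hsym e1 e2 e3 1 = e1.
Proof. by rewrite /hsym /= mulr1 !mulr0 subr0 addr0. Qed.

Lemma hsym2 (S : pzRingType) (e1 e2 e3 : S) : hsym e1 e2 e3 2 = e1 * e1 - e2.
Proof. by rewrite /hsym /= !mulr1 !mulr0 subr0 !addr0. Qed.

Lemma rmorph_hsym (S T : pzRingType) (f : {rmorphism S -> T}) (e1 e2 e3 : S) k :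
  f (hsym e1 e2 e3 k) = hsym (f e1) (f e2) (f e3) k.
Proof.
rewrite /hsym.
suff -> : hcomp (f e1) (f e2) (f e3) k =
    let: (a, b, c) := hcomp e1 e2 e3 k in (f a, f b, f c).
  by case: hcomp => [[a b] c].
elim: k => [|k /= ->]; first by rewrite /= rmorph1 rmorph0.
by case: hcomp => [[a b] c]; rewrite rmorphD rmorphB !rmorphM.
Qed.

(* Up to the factor t^(k+2), the error in truncating the expansion
   sum_k h_k t^k of 1 / (1 - e1 t + e2 t^2 - e3 t^3) after k + 2 terms, taken at
   the root t = 1 of the denominator. *)
Lemma hsym_root (S : comPzRingType) (e1 e2 e3 : S) k :
  1 - e1 + e2 - e3 = 0 ->
  hsym e1 e2 e3 k.+2 + (1 - e1) * hsym e1 e2 e3 k.+1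
    + (1 - e1 + e2) * hsym e1 e2 e3 k = 1.
Proof.
move=> e_eq0; elim: k => [|k IHk]; first by rewrite hsym2 hsym1 hsym0; ring.
rewrite -[RHS]IHk hsymSSS; apply/eqP; rewrite -subr_eq0.
set a := hsym _ _ _ k.+2; set b := hsym _ _ _ k.+1; set c := hsym _ _ _ k.
suff -> : e1 * a - e2 * b + e3 * c + (1 - e1) * a + (1 - e1 + e2) * b -
  (a + (1 - e1) * b + (1 - e1 + e2) * c) = - (1 - e1 + e2 - e3) * c.
  by rewrite e_eq0 oppr0 mul0r.
by ring.
Qed.

(** Splitting off [c], then [b], removes variables one at a time: h_n(a,b,c) - c h_(n-1)(a,b,c) =
    h_n(a,b), and likewise h_n(a,b) - b h_(n-1)(a,b) = a^n. Undoing this yields the bounds r^n,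
    (n+1) r^n and (n+1)^2 r^n in turn. *)
Lemma norm_hsym_le (F : numDomainType) (a b c r : F) k :
  `|a| <= r -> `|b| <= r -> `|c| <= r ->
  `|hsym (a + b + c) (a * b + b * c + c * a) (a * b * c) k|
    <= k.+1%:R ^+ 2 * r ^+ k.
Proof.
move=> ar br cr; set h := hsym _ _ _.
have r0 : 0 <= r by apply: le_trans ar.
have h0 : h 0 = 1 by rewrite /h hsym0.
have h1 : h 1 = a + b + c by rewrite /h hsym1.
have h2 : h 2 = (a + b + c) * (a + b + c) - (a * b + b * c + c * a).
  by rewrite /h hsym2.
have hSSS n : h n.+3 = (a + b + c) * h n.+2 - (a * b + b * c + c * a) * h n.+1
    + a * b * c * h n by rewrite /h hsymSSS.
have gE n : (h n.+2 - c * h n.+1) - b * (h n.+1 - c * h n) = a ^+ n.+2.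
  elim: n => [|n IHn]; first by rewrite h0 h1 h2; ring.
  by rewrite exprS -IHn hSSS; ring.
have d_le n : `|h n.+1 - c * h n| <= n.+2%:R * r ^+ n.+1.
  elim: n => [|n IHn].
    rewrite h0 h1 mulr1 addrK expr1 mulr_natl mulr2n.
    by apply: le_trans (ler_normD _ _) _; apply: lerD.
  rewrite -(subrK (b * (h n.+1 - c * h n)) (h n.+2 - _)) gE.
  apply: le_trans (ler_normD _ _) _.
  rewrite (_ : n.+3%:R * r ^+ n.+2 = r ^+ n.+2 + r * (n.+2%:R * r ^+ n.+1)).
    by rewrite normrX normrM lerD ?lerXn2r ?ler_pM // ?nnegrE.
  by rewrite -[n.+3%:R]natr1 (exprS r n.+1); ring.
elim: k => [|k IHk]; first by rewrite h0 normr1 expr0 expr1n mulr1.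
rewrite -(subrK (c * h k) (h k.+1)).
apply: le_trans (ler_normD _ _) _.
apply: (@le_trans _ _ (k.+2%:R * r ^+ k.+1 + r * (k.+1%:R ^+ 2 * r ^+ k))).
  by rewrite normrM lerD // ler_pM.
rewrite mulrCA -exprS -mulrDl ler_wpM2r ?exprn_ge0 //.
by rewrite -!natrX -natrD ler_nat; lia.
Qed.

(** Take [a] a root of T^3 - e1 T^2 + e2 T - e3, [b] a root of the quotient by T - a, and let [e1]
    determine [c]. *)
Lemma closed_field_sym3 (F : closedFieldType) (e1 e2 e3 : F) :
  exists a b c, [/\ e1 = a + b + c, e2 = a * b + b * c + c * a
                  & e3 = a * b * c].
Proof.
have [a aE] := @solve_monicpoly F 3%N (fun i => [:: e3; - e2; e1]`_i) isT.
have [b bE] := @solve_monicpoly F 2%N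
  (fun i => [:: - (a ^+ 2 - e1 * a + e2); e1 - a]`_i) isT.
rewrite !big_ord_recl !big_ord0 /bump /= in aE bE.
have e2E : e2 = (e1 - a) * b - b ^+ 2 - a ^+ 2 + e1 * a by rewrite bE; ring.
exists a, b, (e1 - a - b); split; first by ring.
  by rewrite {1}e2E; ring.
have -> : e3 = a ^+ 3 - e1 * a ^+ 2 + e2 * a by rewrite aE; ring.
by rewrite e2E; ring.
Qed.

(** * Closed and compact sets over the complex numbers *)

Lemma meval_continuous (K : numFieldType) n (f : mpoly.mpoly n K) :
  continuous (fun x : 'rV[K]_n => mpoly.meval (fun i => x 0 i) f).
Proof.
elim/mpoly.mpolyind: f => [|c m p _ _ IHp] x.
  rewrite [X in continuous_at _ X](_ : _ = cst 0); first exact: cst_continuous.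
  by apply/funext => y; rewrite mpoly.meval0.
rewrite [X in continuous_at _ X](_ : _ = fun y : 'rV[K]_n =>
    c * \prod_(i < n) y 0 i ^+ mpoly.fun_of_multinom m i
    + mpoly.meval (fun i => y 0 i) p); last first.
  by apply/funext => y; rewrite mpoly.mevalD mpoly.mevalZ mpoly.mevalX.
apply: cvgD (IHp x).
apply: cvgMl_tmp; elim: (index_enum _) => [|i s IHs].
  rewrite big_nil; under eq_fun do rewrite big_nil; exact: cvg_cst.
rewrite big_cons; under eq_fun do rewrite big_cons; apply: cvgM IHs.
elim: (mpoly.fun_of_multinom m i) => [|k IHk]; first exact: cvg_cst.
rewrite exprS; under eq_fun do rewrite exprS; apply: cvgM IHk.
exact: coord_continuous.
Qed.

Lemma closed_norm_le1 (K : numClosedFieldType) (T : topologicalType) (f : T -> K) :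
  continuous f -> closed [set x | `|f x| <= 1].
Proof.
move=> /continuous_closedP fc; apply: (fc [set y | `|y| <= 1]).
move=> y /= yA; rewrite real_leNgt //; apply/negP => y1.
have [w [/= w1]] := yA _ (nbhsx_ballx y (`|y| - 1) ltac:(by rewrite subr_gt0)).
rewrite -ball_normE /= => yw.
have : `|y| < `|y|; last by rewrite ltxx.
rewrite -{1}(subrK w y); apply: le_lt_trans (ler_normD _ _) _.
by rewrite -[ltRHS](subrK 1) ltr_leD.
Qed.

Lemma cmodE (R : realType) (z : C R) : `|z| = (cmod z)%:C%C.
Proof. by rewrite /cmod normc_def. Qed.

Lemma compact_square (R : realType) (r : R) :
  compact [set z : C R | `|complex.Re z| <= r /\ `|complex.Im z| <= r].
Proof.
pose f (p : R * R) : C R := (p.1 +i* p.2)%C.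
pose I := [set x : R | `|x| <= r].
rewrite (_ : [set _ | _] = f @` (I `*` I)); last first.
  apply/seteqP; split=> [[x y] /= [xr yr]|_ [[x y] /= [xr yr] <-]] //=.
  by exists (x, y).
apply: continuous_compact; last first.
  have Ic : compact I.
    rewrite (_ : I = `[- r, r]%classic); first exact: segment_compact.
    by apply/seteqP; split=> x; rewrite /I /= in_itv /= ler_norml.
  exact: compact_setX.
apply: continuous_subspaceT => -[x y].
apply/cvgrPdist_lt => /= e e0.
(* The radius [e] lives in [C R]; being positive, it has zero imaginary part. Half of it is allotted
   to each real coordinate. *)
have eE : e = (complex.Re e)%:C%C.
  by case: e e0 => a b; rewrite ltcE /= => /andP[/eqP -> _].
have d0 : 0 < complex.Re e / 2.
  by rewrite divr_gt0 //; move: e0; rewrite eE ltcR.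
exists (ball x (complex.Re e / 2), ball y (complex.Re e / 2)).
  by split; apply: nbhsx_ballx.
move=> [x' y'] /= []; rewrite -!ball_normE /= => dx dy.
rewrite (_ : f (x, y) - f (x', y') = (x - x')%:C%C + 'i%C * (y - y')%:C%C); last first.
  by rewrite /f; simpc.
apply: le_lt_trans (ler_normD _ _) _.
rewrite eE normrM !normc_def /= !expr0n /= expr1n !add0r !addr0 sqrtr1 !sqrtr_sqr.
rewrite mul1r -rmorphD ltcR; lra.
Qed.

(** * Determinants and the surjectivity of [pi3] *)

Lemma det_mx33 (S : comPzRingType) (M : 'M[S]_3) :
  \det M = M 0 0 * (M 1 1 * M 2 2 - M 1 2 * M 2 1)
         - M 0 1 * (M 1 0 * M 2 2 - M 1 2 * M 2 0)
         + M 0 2 * (M 1 0 * M 2 1 - M 1 1 * M 2 0).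
Proof.
(* Indexing by natural numbers lets the lifted indices of the cofactor expansion reduce by
   computation. *)
pose g i j := M (inord i) (inord j).
have gE i j : M i j = g i j by rewrite /g !inord_val.
rewrite (_ : \det M = \det (\matrix_(i < 3, j < 3) g i j)); last first.
  by congr (\det _); apply/matrixP => i j; rewrite mxE.
rewrite !gE (expand_det_row _ 0) !big_ord_recl big_ord0 /cofactor.
rewrite !(expand_det_row _ 0) !big_ord_recl !big_ord0 /cofactor !det_mx11 !mxE.
by rewrite /= /bump /=; ring.
Qed.

(* The coefficients of -t, t^2 and -t^3 in det (I - t A diag(z)), x = pi(A). *)
Definition pol_e1 (S : pzRingType) (x : 'I_7 -> S) (z : 'I_3 -> S) : S :=
  x 0 * z 0 + x 1 * z 1 + x 3 * z 2.
Definition pol_e2 (S : pzRingType) (x : 'I_7 -> S) (z : 'I_3 -> S) : S :=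
  x 2 * (z 0 * z 1) + x 4 * (z 0 * z 2) + x 5 * (z 1 * z 2).
Definition pol_e3 (S : pzRingType) (x : 'I_7 -> S) (z : 'I_3 -> S) : S :=
  x 6 * (z 0 * z 1 * z 2).

Definition det_pol (S : pzRingType) (x : 'I_7 -> S) (z : 'I_3 -> S) : S :=
  1 - pol_e1 x z + pol_e2 x z - pol_e3 x z.

(** Up to sign, the coefficient of each product of diagonal entries of [X] is a principal minor of
    [A], and these minors are the coordinates of [pi3 A]. *)
Lemma det_sub_mul_diag (R : realType) (A X : 'M[C R]_3) : is_diag_mx X ->
  \det (1%:M - A *m X) = det_pol (pi3 A 0) (fun i => X i i).
Proof.
move=> /is_diag_mxP Xdiag.
rewrite /det_pol /pol_e1 /pol_e2 /pol_e3 !mxE /= !det_mx33 !mxE.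
rewrite !big_ord_recl !big_ord0.
have l0 : lift (ord0 : 'I_3) (ord0 : 'I_2) = 1 by apply/val_inj.
have l1 : lift (ord0 : 'I_3) (lift (ord0 : 'I_2) (ord0 : 'I_1)) = 2 by apply/val_inj.
rewrite !l0 !l1 (_ : ord0 = 0) //.
rewrite (Xdiag 0 1) // (Xdiag 0 2) // (Xdiag 1 0) // (Xdiag 1 2) //.
rewrite (Xdiag 2 0) // (Xdiag 2 1) //=.
by ring.
Qed.

(* The two 3-cycles s = a b c and t = p q r / s in the expansion of a 3 x 3
   determinant are the roots of s^2 - w s + p q r, which is solvable in s. *)
Lemma cycle_products_surj (F : closedFieldType) (p q r w : F) :
  exists a a' b b' c c' : F, [/\ a * a' = p, b * b' = q, c * c' = r
    & a * b * c + a' * b' * c' = w].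
Proof.
(* If [p], [q] or [r] vanishes, a root [s] may be 0 and cannot be divided by. A zero factor then
   kills the second cycle, and the first is set to [w]. *)
have [->|p0] := eqVneq p 0; first by exists w, 0, 1, q, 1, r; split; ring.
have [->|q0] := eqVneq q 0; first by exists 1, p, w, 0, 1, r; split; ring.
have [->|r0] := eqVneq r 0; first by exists 1, p, 1, q, w, 0; split; ring.
have [s] := @solve_monicpoly F 2%N (fun i => [:: - (p * q * r); w]`_i) isT.
rewrite !big_ord_recl big_ord0 /bump /= expr1 expr0 => sE.
have s0 : s != 0.
  apply/eqP => s0; move: sE; rewrite s0 => /eqP.
  rewrite expr0n mulr0 !addr0 mulr1 eq_sym oppr_eq0 !mulf_eq0.
  by rewrite (negbTE p0) (negbTE q0) (negbTE r0).
have wE : w = (s ^+ 2 + p * q * r) / s by rewrite sE; field.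
by exists s, (p / s), 1, q, 1, r; split; rewrite ?wE; field.
Qed.

Lemma Ordinal_natr n i (lt_in : (i < n.+2)%N) : Ordinal lt_in = i%:R.
Proof. by apply/val_inj; rewrite /= Zp_nat /= modn_small. Qed.

(** The coordinates of [x] prescribe the diagonal entries, the products [p], [q], [r] of opposite
    off-diagonal entries and, through the determinant, the sum of the two 3-cycles. *)
Lemma pi3_surj (R : realType) (x : 'rV[C R]_7) : exists A, pi3 A = x.
Proof.
pose p := x 0 0 * x 0 1 - x 0 2.
pose q := x 0 1 * x 0 3 - x 0 5.
pose r := x 0 0 * x 0 3 - x 0 4.
have [a [a' [b [b' [c [c' [aE bE cE wE]]]]]]] := cycle_products_surj p q r
  (x 0 6 - (x 0 0 * x 0 1 * x 0 3 - x 0 0 * q - x 0 1 * r - x 0 3 * p)).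
pose B := [:: [:: x 0 0; a; c']; [:: a'; x 0 1; b]; [:: c; b'; x 0 3]].
exists (\matrix_(i, j) (nth [::] B i)`_j).
have detE : x 0 6 = a * b * c + a' * b' * c'
  + (x 0 0 * x 0 1 * x 0 3 - x 0 0 * q - x 0 1 * r - x 0 3 * p).
  by rewrite wE subrK.
apply/rowP => i; rewrite !mxE det_mx33 !mxE.
case: i => [[|[|[|[|[|[|[|//]]]]]]] ilt]; rewrite Ordinal_natr //=.
- by rewrite aE /p; ring.
- by rewrite (mulrC c') cE /r; ring.
- by rewrite bE /q; ring.
- by rewrite detE -aE -bE -cE; ring.
Qed.

(** * The condition on [mu] as absence of zeros in the polydisc *)

(** With M the sum of the [|x k|], each monomial in [z] is at most 1 / (1 + M), so the nonconstant
    part of [det_pol] is at most M / (1 + M) < 1. This keeps the infimum in [mu] away from 0. *)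
Lemma det_pol_neq0_small (F : numFieldType) (x : 'I_7 -> F) (z : 'I_3 -> F) :
  (forall i, `|z i| <= (1 + \sum_k `|x k|)^-1) -> det_pol x z != 0.
Proof.
set M := \sum_k _; set r := _^-1 => z_le.
have M0 : 0 <= M by rewrite sumr_ge0.
have M1_gt0 : 0 < 1 + M by rewrite ltr_wpDr.
have r1 : r <= 1 by rewrite invf_le1 // lerDl.
have r0 : 0 <= r by rewrite invr_ge0 ltW.
have z2_le i j : `|z i * z j| <= r.
  by rewrite normrM -[leRHS]mulr1 ler_pM // (le_trans (z_le j)).
have z3_le i j k : `|z i * z j * z k| <= r.
  by rewrite normrM -[leRHS]mulr1 ler_pM // (le_trans (z_le k)).
apply/eqP => P0.
have : `|pol_e1 x z - pol_e2 x z + pol_e3 x z| <= M * r.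
  apply: le_trans (ler_normD _ _) _.
  apply: le_trans (lerD (ler_normB _ _) (lexx _)) _.
  have -> : M = `|x 0| + `|x 1| + `|x 2| + `|x 3| + `|x 4| + `|x 5| + `|x 6|.
    rewrite /M !big_ord_recl big_ord0 addr0 !addrA.
    by do 6?congr (_ + _); congr `|x _|; apply: val_inj.
  have x_le k w : `|w| <= r -> `|x k * w| <= `|x k| * r.
    by rewrite normrM; apply: ler_wpM2l.
  have norm3_le (a b c : F) : `|a + b + c| <= `|a| + `|b| + `|c|.
    apply: le_trans (ler_normD _ _) _; rewrite lerD2r; exact: ler_normD.
  have -> : (`|x 0| + `|x 1| + `|x 2| + `|x 3| + `|x 4| + `|x 5| + `|x 6|) * r
    = (`|x 0| * r + `|x 1| * r + `|x 3| * r)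
    + (`|x 2| * r + `|x 4| * r + `|x 5| * r) + `|x 6| * r by ring.
  rewrite lerD // ?lerD ?x_le //; apply: le_trans (norm3_le _ _ _) _; rewrite !lerD ?x_le //.
have -> : pol_e1 x z - pol_e2 x z + pol_e3 x z = 1.
  by apply/eqP; rewrite -subr_eq0 -oppr_eq0 -P0 /det_pol; apply/eqP; ring.
rewrite normr1 /r ler_pdivlMr // mul1r; apply/negP.
by rewrite -real_ltNge ?realE ?ler01 ?(ltW M1_gt0) ?M0 // ltrDr.
Qed.

Lemma cmod_ge0 (R : realType) (z : C R) : 0 <= cmod z.
Proof. by rewrite /cmod normc_def sqrtr_ge0. Qed.

Lemma cmodM (R : realType) (z w : C R) : cmod (z * w) = cmod z * cmod w.
Proof. by apply: complexI; rewrite rmorphM -!cmodE normrM. Qed.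

Lemma cmod0 (R : realType) : cmod (0 : C R) = 0.
Proof. by rewrite /cmod normr0. Qed.

Lemma cmod1 (R : realType) : cmod (1 : C R) = 1.
Proof. by rewrite /cmod normr1. Qed.

Lemma vnorm2_delta (R : realType) n (i : 'I_n) (c : C R) :
  vnorm2 (c *: delta_mx i 0) = cmod c.
Proof.
rewrite /vnorm2 (bigD1 i) //= big1 => [|j j_neq_i].
  by rewrite !mxE !eqxx mulr1 addr0 sqrtr_sqr ger0_norm ?cmod_ge0.
by rewrite !mxE (negbTE j_neq_i) mulr0 cmod0 expr0n.
Qed.

Lemma vnorm2_diag_le (R : realType) n (X : 'M[C R]_n) (v : 'cV_n) (r : R) :
  is_diag_mx X -> 0 <= r -> (forall i, cmod (X i i) <= r) ->
  vnorm2 (X *m v) <= r * vnorm2 v.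
Proof.
move=> /is_diag_mxP Xdiag r0 X_le.
rewrite /vnorm2 -{1}(ger0_norm r0) -sqrtr_sqr -sqrtrM ?sqr_ge0 //.
rewrite ler_wsqrtr // mulr_sumr ler_sum // => i _.
rewrite mxE (bigD1 i) //= big1 => [|j ji]; last first.
  by rewrite Xdiag ?mul0r // eq_sym.
by rewrite addr0 cmodM exprMn ler_wpM2r ?sqr_ge0 // lerXn2r // nnegrE ?cmod_ge0.
Qed.

Lemma opnorm_diag_le (R : realType) n (X : 'M[C R]_n) (r : R) :
  is_diag_mx X -> 0 <= r -> (forall i, cmod (X i i) <= r) -> opnorm X <= r.
Proof.
move=> Xdiag r0 X_le; apply: ge_sup.
  exists (vnorm2 (X *m 0)), 0 => //=.
  rewrite /vnorm2 big1 ?sqrtr0 // => i _.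
  by rewrite mxE cmod0 expr0n.
move=> _ [v /= v1 <-]; apply: le_trans (vnorm2_diag_le v Xdiag r0 X_le) _.
by rewrite ler_piMr.
Qed.

(** The i-th basis vector is a unit eigenvector for [X i i]. Together with [opnorm_diag_le], this
    makes [opnorm X] the largest modulus on the diagonal. *)
Lemma opnorm_diag_ge (R : realType) n (X : 'M[C R]_n) i :
  is_diag_mx X -> cmod (X i i) <= opnorm X.
Proof.
move=> Xdiag; pose r := \sum_j cmod (X j j).
have r0 : 0 <= r by rewrite sumr_ge0 // => j _; apply: cmod_ge0.
have X_le j : cmod (X j j) <= r.
  by rewrite /r (bigD1 j) //= lerDl sumr_ge0 // => k _; apply: cmod_ge0.
have Xi_le : [set vnorm2 (X *m v) | v in [set v | vnorm2 v <= 1]] (cmod (X i i)).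
  exists (1 *: delta_mx i 0); first by rewrite /= vnorm2_delta cmod1.
  rewrite scale1r -(vnorm2_delta i).
  suff -> : X *m delta_mx i (0 : 'I_1) = X i i *: delta_mx i 0 by [].
  apply/colP => j; rewrite !mxE (bigD1 i) //= big1 => [|k ki]; last first.
    by rewrite !mxE (negbTE ki) mulr0.
  rewrite !mxE !eqxx mulr1 addr0; have [->|ji] := eqVneq j i; first by rewrite mulr1.
  by rewrite mulr0; move/is_diag_mxP: Xdiag => ->.
apply: (sup_upper_bound _ Xi_le); split; first by eexists; exact: Xi_le.
exists r => _ [v /= v1 <-]; apply: le_trans (vnorm2_diag_le v Xdiag r0 X_le) _.
by rewrite ler_piMr.
Qed.

(** A zero [z] in the open polydisc is a singular diagonal matrix of norm below 1, which pushes the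
    infimum below 1; without such zeros every competitor has norm at least 1. *)
Lemma mu_E3_le1 (R : realType) (A : 'M[C R]_3) :
  mu (E3 R) A <= 1 <->
  forall z : 'I_3 -> C R, (forall i, `|z i| < 1) -> det_pol (pi3 A 0) z != 0.
Proof.
rewrite /mu; set S := [set X : 'M[C R]_3 | _].
have cmod_lt (w : C R) (r : R) : (cmod w < r) = (`|w| < r%:C%C).
  by rewrite cmodE ltcR.
split=> [|z_neq0]; last first.
  case: asboolP => [//|/eqP/set0P[X XS]].
  have inf_ge1 : 1 <= inf [set opnorm X | X in S].
    apply: lb_le_inf; first by exists (opnorm X), X.
    move=> _ [Y /= [Ydiag detY] <-]; rewrite leNgt; apply/negP => Y1.
    have : det_pol (pi3 A 0) (fun i => Y i i) != 0.
      apply: z_neq0 => i; rewrite -[1]/(1%:C)%C -cmod_lt.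
      exact: le_lt_trans (opnorm_diag_ge i Ydiag) Y1.
    by rewrite -det_sub_mul_diag // detY eqxx.
  by rewrite invf_le1 // (lt_le_trans ltr01).
move=> mu_le1 z z1; apply/eqP => P0.
pose D := diag_mx (\row_i z i).
have DE i : D i i = z i by rewrite !mxE eqxx.
have Ddiag : is_diag_mx D by apply: diag_mx_is_diag.
have SD : S D.
  by split=> //; rewrite det_sub_mul_diag // -[RHS]P0; congr det_pol; apply/funext.
case: asboolP mu_le1 => [S0|_]; first by rewrite S0 in SD.
apply/negP; rewrite -ltNge.
(* As [0^-1] is 0, an infimum below 1 gives an inverse above 1 only if it is positive; [r] is a
   positive lower bound. *)
pose r := (1 + \sum_k cmod (pi3 A 0 k))^-1.
have r0 : 0 < r.
  by rewrite invr_gt0 ltr_wpDr // sumr_ge0 // => k _; apply: cmod_ge0.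
have rE : (r%:C)%C = (1 + \sum_k `|pi3 A 0 k|)^-1.
  rewrite fmorphV rmorphD rmorph1 rmorph_sum.
  by under [in RHS]eq_bigr do rewrite cmodE.
have r_lb : lbound [set opnorm X | X in S] r.
  move=> _ [Y /= [Ydiag detY] <-]; rewrite leNgt; apply/negP => Y_lt.
  have : det_pol (pi3 A 0) (fun i => Y i i) != 0.
    apply: det_pol_neq0_small => i; rewrite -rE ltW // -cmod_lt.
    exact: le_lt_trans (opnorm_diag_ge i Ydiag) Y_lt.
  by rewrite -det_sub_mul_diag // detY eqxx.
have S_neq0 : [set opnorm X | X in S] !=set0 by exists (opnorm D), D.
rewrite invf_gt1; last exact: lt_le_trans r0 (lb_le_inf S_neq0 r_lb).
apply: (@le_lt_trans _ _ (opnorm D)).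
  by apply: ge_inf; [exists r | exists D].
pose m := \big[Order.max/0]_i cmod (z i).
apply: (@le_lt_trans _ _ m).
  apply: opnorm_diag_le => // [|i]; first exact: bigmax_ge_id.
  by rewrite DE; apply: le_bigmax.
by apply/bigmax_ltP; split=> // i _; rewrite cmod_lt.
Qed.

(** Bernoulli's inequality for r^-1 = 1 + d gives r^m <= 1 / (m d). Its cube, with k = 3m, decays
    fast enough to beat the quadratic factor. *)
Lemma sqr_mul_expr_lt1 (R : realType) (M r : R) : 0 < r < 1 ->
  exists k : nat, M * k.+3%:R ^+ 2 * r ^+ k < 1.
Proof.
move=> /andP[r0 r1]; pose d := r^-1 - 1.
have d0 : 0 < d by rewrite subr_gt0 invf_gt1.
have rd : r * (1 + d) = 1 by rewrite /d subrKC mulfV ?gt_eqF.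
have bern m : r ^+ m * (1 + m%:R * d) <= 1.
  elim: m => [|m IHm]; first by rewrite expr0 mul0r addr0 mulr1.
  apply: le_trans IHm; rewrite exprSr -mulrA ler_wpM2l ?exprn_ge0 ?(ltW r0) //.
  have -> : r * (1 + m.+1%:R * d) = r * (1 + d) + r * (m%:R * d).
    by rewrite -[m.+1%:R]natr1; ring.
  rewrite rd.
  by rewrite lerD2l ler_piMl ?mulr_ge0 ?(ltW r1) ?(ltW d0).
(* For m >= 1, k + 3 = 3m + 3 is at most 6m, whose square contributes the 36. *)
have [m m_gt] : exists m : nat, 36 * `|M| / d ^+ 3 < m%:R.
  exists (Num.truncn (36 * `|M| / d ^+ 3)).+1.
  by rewrite truncnS_gt.
have m0 : 0 < m%:R :> R.
  by apply: le_lt_trans m_gt; rewrite !mulr_ge0 // invr_ge0 exprn_ge0 // ltW.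
have m1 : 1 <= m%:R :> R by rewrite ler1n -(ltr0n R).
exists (3 * m)%N.
rewrite (_ : (3 * m).+3%:R = 3 * m%:R + 3); last first.
  by rewrite -natrM -natrD addn3.
rewrite mulnC exprM.
set q := r ^+ m; have q0 : 0 <= q by rewrite exprn_ge0 // ltW.
rewrite ltr_pdivrMr ?exprn_gt0 // in m_gt.
have dm0 : 0 < (m%:R * d) ^+ 3 by rewrite exprn_gt0 // mulr_gt0.
rewrite -(ltr_pM2r dm0) mul1r.
have u1 : q * (m%:R * d) <= 1 by apply: le_trans (bern m); rewrite ler_wpM2l // lerDr.
have u0 : 0 <= q * (m%:R * d) by rewrite mulr_ge0 // mulr_ge0 // ltW.
apply: (@le_lt_trans _ _ (`|M| * (3 * m%:R + 3) ^+ 2 * (q * (m%:R * d)) ^+ 3)).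
  rewrite [(q * _) ^+ 3]exprMn [leRHS]mulrA ler_wpM2r ?(ltW dm0) //.
  rewrite (ler_wpM2r (exprn_ge0 3 q0)) //.
  by rewrite ler_wpM2r ?sqr_ge0 // ler_norm.
apply: (@le_lt_trans _ _ (`|M| * (6 * m%:R) ^+ 2)).
  have m_le : (3 * m%:R + 3) ^+ 2 <= (6 * m%:R) ^+ 2 :> R.
    by rewrite lerXn2r ?nnegrE; lra.
  apply: le_trans (ler_wpM2l (normr_ge0 M) m_le).
  by rewrite ler_piMr ?mulr_ge0 ?sqr_ge0 // exprn_ile1.
rewrite (_ : _ * _ = 36 * `|M| * m%:R ^+ 2); last by ring.
rewrite (_ : (m%:R * d) ^+ 3 = m%:R * d ^+ 3 * m%:R ^+ 2); last by ring.
by rewrite ltr_pM2r // exprn_gt0.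
Qed.

(** * Points of Gamma: zeros, roots and bounds on coordinates *)

Lemma Gamma3P (R : realType) (x : 'rV[C R]_7) : Gamma3 R x <->
  forall z : 'I_3 -> C R, (forall i, `|z i| < 1) -> det_pol (x 0) z != 0.
Proof.
split=> [[A /= /mu_E3_le1 A1 <-] //|xP].
by have [A AE] := pi3_surj x; exists A => //=; apply/mu_E3_le1; rewrite AE.
Qed.

(** A root [t] with [|t| > r] would put z / t in the open polydisc, where [det_pol] equals (t - a)(t
    - b)(t - c) / t^3 = 0. *)
Lemma Gamma3_roots (R : realType) (x : 'rV[C R]_7) (z : 'I_3 -> C R) (r : C R) :
  Gamma3 R x -> 0 < r -> (forall i, `|z i| <= r) ->
  exists a b c, [/\ pol_e1 (x 0) z = a + b + c,
    pol_e2 (x 0) z = a * b + b * c + c * a, pol_e3 (x 0) z = a * b * c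
    & [/\ `|a| <= r, `|b| <= r & `|c| <= r]].
Proof.
move=> /Gamma3P xP r0 zr.
have [a [b [c [e1E e2E e3E]]]] :=
  closed_field_sym3 (pol_e1 (x 0) z) (pol_e2 (x 0) z) (pol_e3 (x 0) z).
suff root_le t : (t - a) * (t - b) * (t - c) = 0 -> `|t| <= r.
  exists a, b, c; split=> //; split; apply: root_le; ring.
move=> t_root; rewrite real_leNgt ?realE ?normr_ge0 ?(ltW r0) //.
apply/negP => rt; have t0 : t != 0 by rewrite -normr_gt0 (lt_trans r0).
have : det_pol (x 0) (fun i => z i / t) != 0.
  apply: xP => i; rewrite normrM normfV ltr_pdivrMr ?normr_gt0 // mul1r.
  exact: le_lt_trans (zr i) rt.
apply/negP; rewrite negbK (_ : det_pol _ _ = (t - a) * (t - b) * (t - c) / t ^+ 3).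
  by rewrite t_root mul0r.
transitivity (1 - pol_e1 (x 0) z / t + pol_e2 (x 0) z / t ^+ 2
                - pol_e3 (x 0) z / t ^+ 3).
  by rewrite /det_pol /pol_e1 /pol_e2 /pol_e3; field.
by rewrite e1E e2E e3E; field.
Qed.

Lemma Gamma3_coord_le (R : realType) (x : 'rV[C R]_7) k :
  Gamma3 R x -> `|x 0 k| <= 3.
Proof.
move=> xG.
have e_le (z : 'I_3 -> C R) : (forall i, `|z i| <= 1) ->
    [/\ `|pol_e1 (x 0) z| <= 3, `|pol_e2 (x 0) z| <= 3
      & `|pol_e3 (x 0) z| <= 3].
  move=> z1; have [a [b [c [-> -> -> [a1 b1 c1]]]]] := Gamma3_roots xG ltr01 z1.
  have norm3_le (u v w : C R) : `|u| <= 1 -> `|v| <= 1 -> `|w| <= 1 ->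
      `|u + v + w| <= 3.
    move=> u1 v1 w1; apply: le_trans (ler_normD _ _) _.
    apply: le_trans (lerD (ler_normD _ _) w1) _.
    by apply: le_trans (lerD (lerD u1 v1) (lexx 1)) _; rewrite -addrA.
  have norm2_le (u v : C R) : `|u| <= 1 -> `|v| <= 1 -> `|u * v| <= 1.
    by move=> u1 v1; rewrite normrM mulr_ile1.
  split; first exact: norm3_le.
    by apply: norm3_le; apply: norm2_le.
  by rewrite (@le_trans _ _ 1) ?norm2_le // ler1n.
(* Entry [i] is 1 when [s] has 0 there and 0 otherwise; the default 0 turns the empty list into (1,
   1, 1). The seven vectors below each isolate one coordinate of [x]. *)
pose z (s : seq nat) (i : 'I_3) : C R := (nth 0%N s i <= 0)%N%:R.
have z1 s i : `|z s i| <= 1 by rewrite /z normr_nat; case: (_ <= _)%N.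
have := (e_le _ (z1 [:: 0; 1; 1]), e_le _ (z1 [:: 1; 0; 1]),
         e_le _ (z1 [:: 1; 1; 0]), e_le _ (z1 [:: 0; 0; 1]),
         e_le _ (z1 [:: 0; 1; 0]), e_le _ (z1 [:: 1; 0; 0]),
         e_le _ (z1 [::]))%N.
rewrite /pol_e1 /pol_e2 /pol_e3 /z /= !(mulr0, mulr1, addr0, add0r).
move=> [[[[[[[x0 _ _] [x1 _ _]] [x3 _ _]] [_ x2 _]] [_ x4 _]] [_ x5 _]] [_ _ x6]].
by case: k => [[|[|[|[|[|[|[|//]]]]]]] klt]; rewrite Ordinal_natr.
Qed.

(** * Test polynomials *)

(** Here [x] is the variable and [z] is constant; the scalar normalises the bound of [norm_hsym_le]
    to 1. *)
Definition test_pol (F : fieldType) (z : 'I_3 -> F) (r : F) (k : nat) :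
    mpoly.mpoly 7 F :=
  let X i := mpoly.mpolyX F (mpoly.mnm1 i) in
  let Z i := mpoly.mpolyC 7 (z i) in
  (k.+1%:R ^+ 2 * r ^+ k)^-1 *:
    hsym (pol_e1 X Z) (pol_e2 X Z) (pol_e3 X Z) k.

Lemma meval_test_pol (F : fieldType) (z : 'I_3 -> F) (r : F) (k : nat) x :
  mpoly.meval x (test_pol z r k) = (k.+1%:R ^+ 2 * r ^+ k)^-1 *
    hsym (pol_e1 x z) (pol_e2 x z) (pol_e3 x z) k.
Proof.
rewrite /test_pol mpoly.mevalZ (rmorph_hsym (mpoly.meval x)).
rewrite /pol_e1 /pol_e2 /pol_e3 !rmorphD !rmorphM /=.
by rewrite !mpoly.mevalXU !mpoly.mevalC.
Qed.

Lemma Gamma3_test_pol_le1 (R : realType) (x : 'rV[C R]_7) z r k :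
  Gamma3 R x -> 0 < r -> (forall i, `|z i| <= r) ->
  `|mpoly.meval (x 0) (test_pol z r k)| <= 1.
Proof.
move=> xG r0 zr; rewrite meval_test_pol.
have [a [b [c [-> -> -> [ar br cr]]]]] := Gamma3_roots xG r0 zr.
have w0 : 0 < k.+1%:R ^+ 2 * r ^+ k by rewrite mulr_gt0 ?exprn_gt0.
rewrite normrM normfV (gtr0_norm w0) mulrC ler_pdivrMr // mul1r.
exact: norm_hsym_le.
Qed.

(** A finite form of the convergence argument: at a zero of [det_pol], [hsym_root] writes 1 as a
    fixed combination of three consecutive h_k, which would tend to 0 if every test polynomial were
    bounded by 1 at [x]. *)
Lemma test_pol_gt1 (R : realType) (x : 'rV[C R]_7) : ~ Gamma3 R x ->
  exists z r k, [/\ 0 < r, forall i, `|z i| <= r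
    & 1 < `|mpoly.meval (x 0) (test_pol z r k)|].
Proof.
move=> xNG; apply: contrapT => no_test; apply/xNG/Gamma3P => z z1.
apply/eqP => P0.
(* The floor [2^-1] makes [r] positive; a maximum of finitely many numbers below 1 stays below 1. *)
pose r := Num.max (2^-1) (\big[Num.max/0]_i cmod (z i)).
have r01 : 0 < r < 1.
  rewrite lt_max invr_gt0 ltr0n gt_max invf_lt1 // ltr1n /=.
  by apply/bigmax_ltP; split=> // i _; move: (z1 i); rewrite cmodE ltcR.
have zr i : `|z i| <= r%:C%C.
  by rewrite cmodE lecR /r le_max le_bigmax orbT.
have rC0 : 0 < r%:C%C by rewrite ltcR; case/andP: r01.
set e1 := pol_e1 (x 0) z; set e2 := pol_e2 (x 0) z; set e3 := pol_e3 (x 0) z.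
have h_le k : `|hsym e1 e2 e3 k| <= k.+1%:R ^+ 2 * r%:C%C ^+ k.
  have w0 : 0 < k.+1%:R ^+ 2 * r%:C%C ^+ k by rewrite mulr_gt0 ?exprn_gt0.
  rewrite real_leNgt ?normr_real ?gtr0_real //; apply/negP => h_gt.
  apply: no_test; exists z, (r%:C)%C, k; split=> //.
  by rewrite meval_test_pol normrM normfV (gtr0_norm w0) mulrC ltr_pdivlMr ?mul1r.
(* The constant sums the moduli of the three coefficients in [hsym_root]. *)
have [k] := sqr_mul_expr_lt1 (1 + cmod (1 - e1) + cmod (1 - e1 + e2)) r01.
apply/negP; rewrite -leNgt -lecR rmorph1 -[leLHS]normr1.
rewrite -[X in `|X| <= _](hsym_root k P0).
rewrite rmorphM rmorphXn rmorphM rmorphXn rmorph_nat !rmorphD rmorph1 /= -!cmodE.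
(* One bound serves all three indices: the largest polynomial factor with the smallest power of
   [r]. *)
have hk_le j : (j <= 2)%N ->
    `|hsym e1 e2 e3 (j + k)| <= k.+3%:R ^+ 2 * r%:C%C ^+ k.
  move=> j2; apply: le_trans (h_le _) _.
  rewrite ler_pM ?exprn_ge0 ?(ltW rC0) //.
    by rewrite lerXn2r ?nnegrE // ler_nat; lia.
  rewrite exprD ler_piMl ?exprn_ge0 ?(ltW rC0) // exprn_ile1 ?(ltW rC0) //.
  by rewrite lecR ltW //; case/andP: r01.
rewrite -mulrA; set W := k.+3%:R ^+ 2 * r%:C%C ^+ k.
rewrite (mulrDl _ _ W) (mulrDl _ _ W) mul1r.
apply: le_trans (ler_normD _ _) _; rewrite lerD //; last first.
  by rewrite normrM ler_wpM2l // (hk_le 0%N).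
apply: le_trans (ler_normD _ _) _; rewrite lerD ?(hk_le 2%N) //.
by rewrite normrM ler_wpM2l // (hk_le 1%N).
Qed.

(** * Compactness and polynomial convexity *)

Lemma closed_Gamma3 (R : realType) : closed (Gamma3 R).
Proof.
pose valid (p : ('I_3 -> C R) * C R * nat) :=
  0 < p.1.2 /\ forall i, `|p.1.1 i| <= p.1.2.
pose f (p : ('I_3 -> C R) * C R * nat) (x : 'rV[C R]_7) :=
  mpoly.meval (fun i => x 0 i) (test_pol p.1.1 p.1.2 p.2).
rewrite (_ : Gamma3 R = \bigcap_(p in valid) [set x | `|f p x| <= 1]).
  apply: closed_bigI => p _; apply: closed_norm_le1; apply: meval_continuous.
apply/seteqP; split=> [x xG p [r0 zr]|x xf]; first exact: Gamma3_test_pol_le1.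
apply: contrapT => /test_pol_gt1[z [r [k [r0 zr]]]].
apply/negP; rewrite -real_leNgt //; exact: (xf (z, r, k)).
Qed.

(** The coordinate bound 3 places Gamma, which is closed, inside a product of seven compact
    squares. *)
Lemma compact_Gamma3 (R : realType) : compact (Gamma3 R).
Proof.
apply: (subclosed_compact (@closed_Gamma3 R)
  (rV_compact (fun _ : 'I_7 => @compact_square R 3))).
move=> x xG i /=; have := Gamma3_coord_le i xG.
rewrite normc_def -(rmorph_nat (real_complex R)) lecR => x_le.
have sqr_le (a b : R) : Num.sqrt (a ^+ 2 + b ^+ 2) <= 3 -> `|a| <= 3.
  by apply: le_trans; rewrite -sqrtr_sqr ler_wsqrtr // lerDl sqr_ge0.
split; first exact: sqr_le x_le.
by apply: sqr_le (_ : Num.sqrt (_ + complex.Re (x 0 i) ^+ 2) <= 3); rewrite addrC.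
Qed.

Theorem theorem3p4 (R : realType) : polynomially_convex (Gamma3 R).
Proof.
split=> [|a /test_pol_gt1[z [r [k [r0 zr f_gt1]]]]]; first exact: compact_Gamma3.
by exists (test_pol z r k); split=> // x xG; apply: Gamma3_test_pol_le1.
Qed.
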